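(* Let $\pi\in\mathfrak{S}_n$ and let $c=(c_1,\dots,c_k)$, $k\ge1$, be a composition (a sequence of positive integers). The following procedure correctly computes $\operatorname{ls}_{D_c}(\pi)$ from the triangle of pairs $a_{i,j}(\pi)$, $1\le i\le j\le n$. Set $j_0=1$. For $t=1,2,\dots,k$ in order, let $j_t$ be the smallest $j$ with $j_{t-1}\le j\le n$ such that - the second entry of $a_{j_{t-1},j}(\pi)$ equals $c_t+1$, if $k-t$ is even; - the first entry of $a_{j_{t-1},j}(\pi)$ equals $c_t+1$, if $k-t$ is odd. If at some step no such $j_t$ exists, then $\operatorname{ls}_{D_c}(\pi)=0$. Otherwise, if $l$ is the first entry of $a_{j_k,n}(\pi)$, then $\operatorname{ls}_{D_c}(\pi)=c_1+c_2+\cdots+c_k+l$.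
   Context: $\mathfrak{S}_n$ is the set of permutations of $[n]=\{1,\dots,n\}$. For $I=\{i_1<\cdots<i_r\}\subseteq[n]$, $\pi_I=\pi(i_1)\cdots\pi(i_r)$, so $\pi_{[i,j]}=\pi(i)\pi(i+1)\cdots\pi(j)$. For a sequence $\sigma$ of distinct numbers, $\operatorname{is}(\sigma)$ and $\operatorname{ds}(\sigma)$ are the lengths of a longest increasing, respectively decreasing, subsequence. For $1\le i\le j\le n$, $a_{i,j}(\pi)=(\operatorname{is}(\pi_{[i,j]}),\operatorname{ds}(\pi_{[i,j]}))$. The descent set of a sequence $\sigma$ of length $r$ is $\operatorname{Des}(\sigma)=\{j\in[r-1]:\sigma(j)>\sigma(j+1)\}$, and $\operatorname{ls}_D(\pi)=\max\{\#I : I\subseteq[n],\ \operatorname{Des}(\pi_I)=D\}$ (equal to $0$ if there is no such $I$). For a composition $c=(c_1,\dots,c_k)$ put $d_i=c_1+\cdots+c_i$. If $k$ is odd, $D_c=[d_1]\cup[d_2+1,d_3]\cup\cdots\cup[d_{k-1}+1,d_k]$. If $k$ is even, $D_c=[d_1+1,d_2]\cup[d_3+1,d_4]\cup\cdots\cup[d_{k-1}+1,d_k]$. *)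

(* Defs.v *)
From mathcomp Require Import all_boot all_fingroup finmap.

Set Implicit Arguments.
Unset Strict Implicit.
Unset Printing Implicit Defensive.

Local Open Scope fset_scope.
Local Open Scope nat_scope.

(** Positions and values are numbered from 1: the ordinal [x : 'I_n] stands for
    the element [x.+1] of {1, ..., n}. *)

(** Since [enum I] is increasing, this is the word pi_I. *)
Definition subword n (pi : 'S_n) (I : {set 'I_n}) : seq nat :=
  [seq (pi x).+1 | x <- enum I].

Definition pos_itv n (i j : nat) : {set 'I_n} := [set x : 'I_n | i <= x.+1 <= j].

(** Boolean masks of length [size s] enumerate the subsequences of [s]. *)
Definition lis (s : seq nat) : nat :=
  \max_(m : (size s).-tuple bool | sorted ltn (mask m s)) size (mask m s).

Definition lds (s : seq nat) : nat :=
  \max_(m : (size s).-tuple bool | sorted gtn (mask m s)) size (mask m s).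

Definition triangle n (pi : 'S_n) (i j : nat) : nat * nat :=
  (lis (subword pi (pos_itv n i j)), lds (subword pi (pos_itv n i j))).

Definition nat_itv (a b : nat) : {fset nat} := [fset x in iota a (b.+1 - a)].

(** With 1-based positions, sigma(j) is [nth 0 s j.-1] and sigma(j+1) is
    [nth 0 s j]. *)
Definition Des (s : seq nat) : {fset nat} :=
  [fset j in nat_itv 1 (size s).-1 | nth 0 s j.-1 > nth 0 s j].

(** The maximum over an empty family is 0. *)
Definition ls n (D : {fset nat}) (pi : 'S_n) : nat :=
  \max_(I : {set 'I_n} | Des (subword pi I) == D) #|I|.

Definition psum (c : seq nat) (i : nat) : nat := sumn (take i c).

(** The block [d_(t-1) + 1, d_t], with d_0 = 0. *)
Definition block (c : seq nat) (t : nat) : {fset nat} :=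
  nat_itv (psum c t.-1).+1 (psum c t).

Definition Dset (c : seq nat) : {fset nat} :=
  if odd (size c) then \bigcup_(t <- iota 1 (size c) | odd t) block c t
  else \bigcup_(t <- iota 1 (size c) | ~~ odd t) block c t.

(** The procedure, which takes as input any array [a] of pairs; it only reads
    the entries [a i j] with 1 <= i <= j <= n. *)

(** The smallest [j] with [i <= j <= n] such that the first entry of [a i j]
    (the second one if [use_snd]) equals [m.+1]. *)
Definition first_reach (a : nat -> nat -> nat * nat) (n : nat)
    (use_snd : bool) (i m : nat) : option nat :=
  ohead [seq j <- iota i (n.+1 - i)
        | (if use_snd then (a i j).2 else (a i j).1) == m.+1].

(** The index j_t; [None] if some step up to the [t]-th one fails. *)
Fixpoint step_index (a : nat -> nat -> nat * nat) (n : nat) (c : seq nat)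
    (t : nat) : option nat :=
  if t is t'.+1 then
    if step_index a n c t' is Some i then
      first_reach a n (~~ odd (size c - t)) i (nth 0 c t')
    else None
  else Some 1.

Definition procedure (a : nat -> nat -> nat * nat) (n : nat) (c : seq nat) : nat :=
  if step_index a n c (size c) is Some j then sumn c + (a j n).1 else 0.

(* Main.v *)
Require Import Defs.
From mathcomp Require Import all_boot all_fingroup finmap.
From mathcomp Require Import zify.

(** Let [w] be the word of [pi]. A word of distinct numbers has descent set
    [Dset c] exactly when it makes [c_1] steps in one direction, then [c_2]
    steps in the other, and so on, the last block being descending, and then
    only ascents ([Des_Dset]). The directions alternate, so consecutive blocks
    share a turning letter.

    Upper bound ([run_upper]): if a subsequence of [w] has this shape, then by
    induction on [t] its [t]-th turning letter is at position [j_t] or later,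
    because the part between two turning letters is a monotone sequence of
    length [c_t + 1] inside the window read by the procedure. So the procedure
    does not fail, and the final ascending run lies in the window from [j_k]
    to [n].

    Lower bound ([run_lower]): concatenate longest monotone subsequences of the
    successive windows. The one for the [t]-th window ends at [j_t], by
    minimality of [j_t]. The one for the next window need not begin at [j_t]:
    it may begin at a later letter [y]. But if [y] lay beyond the letter at
    [j_t] in the direction of that next window, the letter at [j_t] could be
    put in front of it and would make it too long ([lmono_head]). Hence [y]
    lies further in the direction of the [t]-th window, and it can replace the
    last letter of the [t]-th monotone sequence. So the pieces always glue, at
    a cost of one shared letter per turn, which gives
    [c_1 + ... + c_k + l] letters in all. The induction runs from the last
    block backwards, over suffixes of [w], and its invariant is this
    alternative on the first letter of the chain. *)

Set Implicit Arguments.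
Unset Strict Implicit.
Unset Printing Implicit Defensive.

(** * Longest monotone subsequences in either direction *)

Definition dir (b : bool) : rel nat := if b then gtn else ltn.

Definition lmono (b : bool) (s : seq nat) : nat := if b then lds s else lis s.

Lemma dir_trans b : transitive (dir b).
Proof.
by case: b => x y z /=; [move=> ? /ltn_trans; apply | apply: ltn_trans].
Qed.

Lemma dir_irr b : irreflexive (dir b).
Proof. by case: b => x; exact: ltnn. Qed.

Lemma dirE b x y : x != y -> dir b x y = (gtn x y == b).
Proof.
case: b => nxy; first by rewrite eqb_id.
by rewrite eqbF_neg [RHS]/= -leqNgt [RHS]leq_eqVlt (negPf nxy).
Qed.

Lemma lmonoE b s : lmono b s =
  \max_(m : (size s).-tuple bool | sorted (dir b) (mask m s)) size (mask m s).
Proof. by case: b. Qed.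

Lemma leq_lmono b t s :
  subseq t s -> sorted (dir b) t -> size t <= lmono b s.
Proof.
case/subseqP=> m sz_m -> sorted_m.
rewrite lmonoE; move/eqP: sz_m => sz_m.
exact: (@leq_bigmax_cond _ (fun m : (size s).-tuple bool => _)
          (fun m : (size s).-tuple bool => size (mask m s)) (Tuple sz_m)).
Qed.

Lemma lmono_witness b s :
  exists t, [/\ subseq t s, sorted (dir b) t & size t = lmono b s].
Proof.
rewrite lmonoE.
have [|m sorted_m ->] := @eq_bigmax_cond _
    (fun m : (size s).-tuple bool => sorted (dir b) (mask m s))
    (fun m : (size s).-tuple bool => size (mask m s)).
  apply/card_gt0P; exists (nseq_tuple (size s) false).
  by rewrite unfold_in /= mask_false.
by exists (mask m s); split=> //; exact: mask_subseq.
Qed.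

Lemma subseq_rcons2 (t s : seq nat) x y :
  subseq (rcons t x) (rcons s y) = subseq (if x == y then t else rcons t x) s.
Proof.
rewrite -subseq_rev !rev_rcons /=.
by case: ifP => _; rewrite -?rev_rcons subseq_rev.
Qed.

Lemma lmono_rcons b s x : lmono b (rcons s x) <= (lmono b s).+1.
Proof.
have [t [+ + <-]] := lmono_witness b (rcons s x).
case/lastP: t => // t y; rewrite subseq_rcons2 size_rcons ltnS.
move=> sub_t sorted_t.
apply: leq_lmono.
  by case: ifP sub_t => // _; apply: subseq_trans; exact: subseq_rcons.
case: t sorted_t {sub_t} => //= z t; by rewrite rcons_path => /andP[].
Qed.

(** A discrete intermediate value property: adding a letter raises [lmono] by
    at most one, so no value is skipped on the way past [m]. This reconciles
    the test for equality made by the procedure with the inequalities that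
    monotone subsequences provide. *)
Lemma lmono_reach b m v e : m < lmono b (take e v) ->
  exists2 d, d < e & lmono b (take d.+1 v) = m.+1.
Proof.
elim: e => [|e IHe].
  by rewrite take0; have [[|? ?] [//= _ _ <-]] := lmono_witness b [::].
case: (ltnP m (lmono b (take e v))) => [/IHe [d lt_de Ed] _|le_m lt_m].
  by exists d => //; exact: ltnW.
exists e => //; apply/eqP; rewrite eqn_leq lt_m andbT.
case: (ltnP e (size v)) => [lt_ev|le_ve].
  rewrite (take_nth 0) //; exact: leq_trans (lmono_rcons _ _ _) _.
by move: le_m; rewrite !take_oversize // => [/leqW|]; lia.
Qed.

(** The gluing alternative: when [y :: s] is a longest monotone subsequence,
    [x0] cannot be put in front of it. *)
Lemma lmono_head b x0 v y s : subseq (y :: s) (x0 :: v) ->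
    path (dir b) y s -> lmono b (x0 :: v) <= size (y :: s) ->
  (y == x0) || (gtn x0 y != b).
Proof.
rewrite [subseq _ _]/=; case: eqVneq => //= ne_y sub_s path_s.
apply: contraTN => /eqP gt_b; rewrite -ltnNge.
apply: (@leq_lmono b (x0 :: y :: s)); first by rewrite /= eqxx.
by rewrite /= path_s andbT dirE 1?eq_sym //; exact/eqP.
Qed.

(** * The steps of the procedure, read on suffixes of the word *)

Lemma ohead_filter_iota (p : pred nat) i k :
  if ohead [seq j <- iota i k | p j] is Some j
  then [/\ i <= j < i + k, p j & forall j', i <= j' < j -> ~~ p j']
  else forall j, i <= j < i + k -> ~~ p j.
Proof.
elim: k i => [|k IHk] i /=; first by move=> j; lia.
case: ifP => /= [pi|npi]; first by split=> // [|j']; lia.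
have p_i j : i <= j -> ~~ (i.+1 <= j) -> ~~ p j.
  by move=> ? ?; have -> : j = i; [lia | rewrite npi].
case: ohead (IHk i.+1) => [j [j_itv pj pN]|pN].
  split=> //; first by lia.
  by move=> j' ?; case: (boolP (i < j')) => ?; [apply: pN|apply: p_i]; lia.
by move=> j' ?; case: (boolP (i < j')) => ?; [apply: pN|apply: p_i]; lia.
Qed.

Definition factor (w : seq nat) i j := take (j.+1 - i) (drop i.-1 w).

(** Only rows with positive index are constrained: on row 0 the truncated
    predecessor makes [factor] differ from the word of an interval. *)
Definition is_triangle (a : nat -> nat -> nat * nat) (w : seq nat) :=
  forall i j, 0 < i -> a i j = (lis (factor w i j), lds (factor w i j)).

Lemma triangle_lmono a w b i j : is_triangle a w -> 0 < i ->
  (if b then (a i j).2 else (a i j).1) = lmono b (factor w i j).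
Proof. by move=> aw i_gt0; rewrite aw //; case: b. Qed.

(** The last bound carries the minimality of [j]: by [lmono_reach], if the
    prefix of length [d] already exceeded [m], an earlier index would have been
    chosen. *)
Lemma first_reach_Some a w b i m j : is_triangle a w -> 0 < i ->
    first_reach a (size w) b i m = Some j ->
  exists d, [/\ j = i + d, d < size (drop i.-1 w),
    lmono b (take d.+1 (drop i.-1 w)) = m.+1 &
    lmono b (take d (drop i.-1 w)) <= m].
Proof.
move=> aw i_gt0 Ej.
have := ohead_filter_iota
  (fun j => (if b then (a i j).2 else (a i j).1) == m.+1) i ((size w).+1 - i).
rewrite -/(first_reach _ _ _ _ _) Ej (triangle_lmono _ _ aw) //.
case=> j_itv /eqP Lj jmin.
exists (j - i); rewrite size_drop.
split; [lia|lia|by rewrite -Lj /factor; congr (lmono b (take _ _)); lia|].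
rewrite leqNgt; apply/negP => /lmono_reach [d lt_d Ld].
have /jmin : i <= i + d < j by lia.
rewrite (triangle_lmono _ _ aw) // -Ld /factor.
by have -> : (i + d).+1 - i = d.+1; [lia | rewrite eqxx].
Qed.

Lemma first_reach_le a w b i m e : is_triangle a w -> 0 < i ->
    e <= size (drop i.-1 w) -> m < lmono b (take e (drop i.-1 w)) ->
  exists2 d, d < e & first_reach a (size w) b i m = Some (i + d).
Proof.
move=> aw i_gt0; rewrite size_drop => le_e /lmono_reach [d lt_de Ld].
have := ohead_filter_iota
  (fun j => (if b then (a i j).2 else (a i j).1) == m.+1) i ((size w).+1 - i).
rewrite -/(first_reach _ _ _ _ _).
have reach_d : (if b then (a i (i + d)).2 else (a i (i + d)).1) == m.+1.
  rewrite (triangle_lmono _ _ aw) // -Ld /factor.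
  by have -> : (i + d).+1 - i = d.+1; [lia | exact: eqxx].
case: first_reach => [j [j_itv _ jmin]|none]; last first.
  by have /none : i <= i + d < i + ((size w).+1 - i); [lia | rewrite reach_d].
exists (j - i); last by congr Some; lia.
rewrite leqNgt; apply/negP => lt_e.
by have /jmin : i <= i + d < j; [lia | rewrite reach_d].
Qed.

(** The iteration started from an arbitrary position [i]. Recursion on the head
    of [c] turns the parity of [k - t] into that of the number of blocks left,
    and lets the correctness proof proceed by induction on [c]. *)
Fixpoint run a n (c : seq nat) i : option nat :=
  if c is m :: c' then obind (run a n c') (first_reach a n (odd (size c)) i m)
  else Some i.

Lemma step_index_run a n c t : t <= size c ->
  obind (run a n (drop t c)) (step_index a n c t) = run a n c 1.
Proof.
elim: t => [|t IHt] lt_t; first by rewrite drop0.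
rewrite -IHt; last exact: ltnW.
rewrite (drop_nth 0 lt_t) /=; case: step_index => //= i.
by rewrite size_drop; congr (obind _ (first_reach _ _ _ _ _)); lia.
Qed.

Lemma procedureE a n c : procedure a n c =
  if run a n c 1 is Some j then sumn c + (a j n).1 else 0.
Proof.
rewrite /procedure -(step_index_run a n (leqnn (size c))) drop_size.
by case: step_index.
Qed.

(** * Chains with a prescribed sequence of directions *)

(** The directions, [true] for a descent, of the steps imposed by [c]. *)
Fixpoint pattern (c : seq nat) : seq bool :=
  if c is m :: c' then nseq m (odd (size c)) ++ pattern c' else [::].

Lemma size_pattern c : size (pattern c) = sumn c.
Proof. by elim: c => //= m c <-; rewrite size_cat size_nseq. Qed.

Lemma path_dir b x s : uniq (x :: s) ->
  path (dir b) x s = (pairmap gtn x s == nseq (size s) b).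
Proof.
elim: s x => //= y s IHs x; rewrite inE negb_or => /andP[/andP[nxy _] u_ys].
by rewrite IHs // eqseq_cons dirE.
Qed.

(** An embedding of [s1 ++ z :: s2] cuts [v] at the image of [z]. *)
Lemma subseq_cat_cons (s1 s2 v : seq nat) z : subseq (s1 ++ z :: s2) v ->
  exists v1 v2, [/\ v = v1 ++ z :: v2, subseq s1 v1 & subseq s2 v2].
Proof.
elim: v s1 => [|y v IHv] s1; first by case: s1.
case: s1 => [|x s1] /=.
  case: eqP => [-> sub_s2|_ /(IHv [::]) [v1 [v2 [-> _ sub2]]]].
    by exists [::], v.
  by exists (y :: v1), v2; split=> //; exact: sub0seq.
case: eqP => [-> /IHv [v1 [v2 [-> sub1 sub2]]]|nxy /(IHv (x :: s1))].
  by exists (y :: v1), v2; rewrite /= eqxx.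
case=> v1 [v2 [-> sub1 sub2]]; exists (y :: v1), v2; split=> //.
exact: subseq_trans sub1 (subseq_cons _ _).
Qed.

(** Each block of the chain fits in a prefix of the current suffix, so the next
    index is found no later than the turning letter [last y s1], and the rest
    of the chain still embeds in the suffix that begins there. *)
Lemma run_upper a w c i y s r : is_triangle a w -> uniq w -> 0 < i ->
    subseq (y :: s) (drop i.-1 w) ->
    pairmap gtn y s = pattern c ++ nseq r false ->
  exists j, [/\ run a (size w) c i = Some j, 0 < j &
    size (y :: s) <= sumn c + lis (drop j.-1 w)].
Proof.
move=> aw uw; elim: c i y s => [|m c IHc] i y s i_gt0 sub_s pat_s.
  exists i; split=> //; apply: (@leq_lmono false) => //.
  have sz_s : size s = r by rewrite -(size_pairmap gtn y) pat_s size_nseq.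
  rewrite /sorted path_dir ?sz_s ?pat_s //.
  exact: subseq_uniq sub_s (drop_uniq _ uw).
set b := odd (size (m :: c)); set v := drop i.-1 w in sub_s *.
have uv : uniq v by exact: drop_uniq.
have le_ms : m <= size s.
  by rewrite -(size_pairmap gtn y) pat_s !size_cat size_nseq; lia.
move: pat_s sub_s; rewrite /= -/b -catA -(cat_take_drop m s).
set s1 := take m s; set s2 := drop m s.
have sz_s1 : size s1 = m by rewrite size_takel.
rewrite pairmap_cat => /eqP; rewrite eqseq_cat ?size_pairmap ?size_nseq //.
case/andP=> /eqP pat1 /eqP pat2; rewrite -cat_cons lastI cat_rcons.
move=> /subseq_cat_cons [v1 [v2 [Ev sub1 sub2]]].
have sub_s1 : subseq (y :: s1) (rcons v1 (last y s1)).
  by rewrite lastI subseq_rcons2 eqxx.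
have Etake : take (size v1).+1 v = rcons v1 (last y s1).
  by rewrite Ev -cat_rcons -(size_rcons v1 (last y s1)) take_size_cat.
have Lm : m < lmono b (take (size v1).+1 v).
  rewrite -sz_s1 Etake; apply: (leq_lmono sub_s1).
  rewrite /sorted path_dir ?sz_s1 ?pat1 //.
  by apply: subseq_uniq sub_s1 _; rewrite -Etake take_uniq.
have [|d lt_d ->] := first_reach_le aw i_gt0 _ Lm.
  by rewrite -/v Ev size_cat /=; lia.
have [||j [Ej j_gt0 le_j]] := IHc (i + d) _ _ _ _ pat2; first by lia.
  have -> : drop (i + d).-1 w = drop d v.
    by rewrite /v drop_drop; congr (drop _ w); lia.
  apply: (@subseq_trans _ (drop (size v1) v)).
    by rewrite Ev drop_size_cat //= eqxx.
  rewrite -(@subnK d (size v1)); last by lia.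
  by rewrite -drop_drop; exact: drop_subseq.
exists j; split=> //.
by move: le_j; rewrite /= size_cat sz_s1; lia.
Qed.

(** The last clause is what allows the induction. It says that the chain begins
    with the letter at position [i], or that the step from that letter to [y]
    goes against the first direction [odd (size c)]. Since directions alternate,
    such a step continues the block that precedes, so [y] may replace its last
    letter. For empty [c] the direction is [false], that of the final ascending
    run. *)
Lemma run_lower a w c i j : is_triangle a w -> uniq w ->
    all (fun m => 0 < m) c -> 0 < i <= size w ->
    run a (size w) c i = Some j ->
  exists y s r, [/\ 0 < j, subseq (y :: s) (drop i.-1 w),
    pairmap gtn y s = pattern c ++ nseq r false,
    size (y :: s) = sumn c + lis (drop j.-1 w) &
    (y == nth 0 w i.-1) || (gtn (nth 0 w i.-1) y != odd (size c))].
Proof.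
move=> aw uw; elim: c i => [|m c IHc] i.
  move=> _ /andP[i_gt0 le_i] /= [<-] {j}.
  have Ev : drop i.-1 w = nth 0 w i.-1 :: drop i w.
    by rewrite (drop_nth 0) ?prednK //; lia.
  have [[|y s] [sub_s path_s sz_s]] := lmono_witness false (drop i.-1 w).
    have : subseq [:: nth 0 w i.-1] (drop i.-1 w) by rewrite Ev /= eqxx sub0seq.
    by move/(@leq_lmono false)/(_ isT); rewrite -sz_s.
  exists y, s, (size s); split=> //.
    apply/eqP; rewrite -path_dir //.
    exact: subseq_uniq sub_s (drop_uniq _ uw).
  by rewrite Ev in sub_s sz_s; apply: lmono_head sub_s _ _ => //; rewrite -sz_s.
case/andP=> m_gt0 c_pos /andP[i_gt0 le_i] /=.
set b := ~~ odd (size c); set v := drop i.-1 w.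
have uv : uniq v by exact: drop_uniq.
case Ei: first_reach => [i'|] //= run_j.
have [d [Ei' lt_d Ld Ld']] := first_reach_Some aw i_gt0 Ei.
rewrite -/v in lt_d Ld Ld'.
have sz_v : size v = size w - i.-1 by rewrite size_drop.
have {IHc} [|z1 [s1 [r [j_gt0 sub1 pat1 sz1 z1P]]]] :=
  IHc i' c_pos _ run_j; first by lia.
have Edrop : drop i'.-1 w = drop d v.
  by rewrite /v drop_drop; congr (drop _ w); lia.
set z := nth 0 w i'.-1 in z1P; have Ez : nth 0 v d = z.
  by rewrite nth_drop /z; congr nth; lia.
have [t [sub_t sorted_t]] := lmono_witness b (take d.+1 v); rewrite Ld.
case/lastP: t sub_t sorted_t => // t z' sub_t sorted_t.
rewrite size_rcons => -[sz_t].
(* A chain not ending with [z] would fit in the window that stops before [z]. *)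
move: (sub_t); rewrite (take_nth 0) // Ez subseq_rcons2; case: eqP; last first.
  by move=> _ /leq_lmono /(_ sorted_t); rewrite size_rcons sz_t ltnNge Ld'.
move=> ? sub_t'; subst z'.
case: t => [|y s] in sub_t sub_t' sorted_t sz_t *.
  by rewrite -sz_t in m_gt0.
move: sorted_t; rewrite /= rcons_path => /andP[path_s dir_z].
have dir_z1 : dir b (last y s) z1.
  case/orP: z1P => [/eqP -> //|gt_z].
  have [-> //|ne_z1] := eqVneq z1 z.
  apply: dir_trans dir_z _; rewrite dirE 1?eq_sym //.
  by move: gt_z; rewrite /b; case: odd; case: (gtn z z1).
have Ev : v = nth 0 w i.-1 :: drop i w.
  by rewrite /v (drop_nth 0) ?prednK //; lia.
(* Here [z1] takes the place of [z]. *)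
have sub_all : subseq ((y :: s) ++ z1 :: s1) v.
  by rewrite -(cat_take_drop d v); apply: cat_subseq => //; rewrite -Edrop.
exists y, (s ++ z1 :: s1), r; split=> //.
- rewrite pairmap_cat /= pat1.
  have /eqP -> : pairmap gtn y s == nseq (size s) b.
    by rewrite -path_dir //; apply: subseq_uniq sub_t' (take_uniq _ uv).
  have ne_z1 : last y s != z1.
    by apply: contraTneq dir_z1 => ->; rewrite dir_irr.
  have -> : (z1 < last y s) = b.
    by move: dir_z1; rewrite dirE // => /eqP.
  have -> : m = size s + 1 by rewrite -sz_t addn1.
  by rewrite nseqD -!catA.
- by rewrite [LHS]/= size_cat sz1 -sz_t -addSn addnA.
case: d {Ei' lt_d Ld Ez sub_t Edrop} => [|d] in Ld' sub_t' *.
  by rewrite take0 in sub_t'.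
rewrite Ev /= in sub_t' Ld'.
by apply: lmono_head sub_t' path_s _; rewrite sz_t.
Qed.

(** * Descent sets as sequences of directions *)

Lemma nth_pattern c i : nth false (pattern c) i =
  has (fun t => ~~ odd (size c - t) && (psum c t.-1 <= i < psum c t))
    (iota 1 (size c)).
Proof.
elim: c i => [|m c IHc] i; first by rewrite nth_nil.
rewrite [pattern _]/= nth_cat size_nseq nth_nseq.
rewrite [size _]/= [iota _ _]/= [has _ _]/=.
rewrite /psum /= take0 addn0 subn1 /= -[2]/(1 + 1) iotaDl has_map.
case: ltnP => [lt_im|le_mi].
  rewrite andbT; case: odd => //=; apply/esym/negbTE/hasPn => t.
  by rewrite mem_iota => /andP[]; case: t => //= t _ _; lia.
rewrite andbF /= IHc; apply: eq_in_has => t; rewrite mem_iota => /andP[].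
by case: t => //= t _ _; rewrite /psum add0n subSS; congr (_ && _); lia.
Qed.

Lemma in_nat_itv a b i : (i \in nat_itv a b) = (a <= i <= b).
Proof. by rewrite inE mem_iota; lia. Qed.

Lemma in_Dset c i : (i.+1 \in Dset c) = nth false (pattern c) i.
Proof.
rewrite nth_pattern.
have -> : Dset c =
    (\bigcup_(t <- iota 1 (size c) | ~~ odd (size c - t)) block c t)%fset.
  rewrite /Dset; case: ifP => odd_c;
    rewrite big_seq_cond [RHS]big_seq_cond;
    apply: eq_bigl => t; rewrite mem_iota; apply: andb_id2l => /andP[_ le_t];
    by rewrite oddB ?odd_c //= negbK.
apply/bigfcupP/hasP => [[t /andP[t_in odd_t]]|[t t_in /andP[odd_t i_in]]].
  by rewrite in_nat_itv ltnS => i_in; exists t; rewrite // odd_t.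
by exists t; rewrite ?t_in // in_nat_itv.
Qed.

Lemma notin0_Dset c : 0 \notin Dset c.
Proof.
rewrite /Dset; case: ifP => _;
  by apply/bigfcupP => -[t _]; rewrite in_nat_itv.
Qed.

Lemma in_Des x s i : (i.+1 \in Des (x :: s)) = nth false (pairmap gtn x s) i.
Proof.
rewrite !inE /= mem_iota subn1 /= add1n ltnS.
case: ltnP => [lt_i|le_i]; first by rewrite (nth_pairmap 0).
by rewrite [RHS]nth_default // size_pairmap.
Qed.

Lemma last_pattern c : c != [::] -> all (fun m => 0 < m) c ->
  last false (pattern c).
Proof.
elim: c => //= m c IHc _ /andP[m_gt0 c_pos].
case: c => [|m' c] in IHc c_pos *; last first.
  by rewrite last_cat; case: (pattern _) (IHc isT c_pos).
by rewrite /= cats0 -(prednK m_gt0) /=; elim: m.-1.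
Qed.

(** Both sets are indexed by positions in sequences of directions. As
    [pattern c] ends with a descent, a word with this descent set cannot be too short, and
    everything after the pattern is an ascent. *)
Lemma Des_Dset c x s : c != [::] -> all (fun m => 0 < m) c ->
  (Des (x :: s) == Dset c) <->
  (exists r, pairmap gtn x s = pattern c ++ nseq r false).
Proof.
move=> c_n0 c_pos; have := last_pattern c_n0 c_pos.
set p := pattern c; set q := pairmap gtn x s => last_p.
have -> : (Des (x :: s) == Dset c) <->
    (forall i, nth false q i = nth false p i).
  split=> [/eqP/fsetP eqD i|eqD]; first by rewrite -in_Dset -in_Des eqD.
  apply/eqP/fsetP => -[|i]; last by rewrite in_Des in_Dset; exact: eqD.
  by rewrite (negPf (notin0_Dset c)) !inE /= mem_iota.
split=> [eq_pq|[r ->] i]; last first.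
  rewrite nth_cat nth_nseq if_same; case: ltnP => // le_i.
  by rewrite nth_default.
have le_pq : size p <= size q.
  rewrite leqNgt; apply: contraL last_p => lt_qp.
  by rewrite -nth_last -eq_pq nth_default // -ltnS prednK //; lia.
exists (size q - size p); apply: (@eq_from_nth _ false).
  by rewrite size_cat size_nseq subnKC.
move=> i _; rewrite eq_pq nth_cat nth_nseq if_same; case: ltnP => // le_i.
by rewrite nth_default.
Qed.

(** * Words of permutations *)

Definition word n (pi : 'S_n) : seq nat := [seq (pi x).+1 | x <- enum 'I_n].

Lemma size_word n (pi : 'S_n) : size (word pi) = n.
Proof. by rewrite size_map size_enum_ord. Qed.

Lemma word_uniq n (pi : 'S_n) : uniq (word pi).
Proof.
by rewrite map_inj_uniq ?enum_uniq // => x y [] /val_inj/perm_inj.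
Qed.

Lemma enum_filter n (I : {set 'I_n}) :
  enum I = [seq x <- enum 'I_n | x \in I].
Proof. by rewrite enumT. Qed.

Lemma subword_subseq n (pi : 'S_n) I : subseq (subword pi I) (word pi).
Proof. by rewrite /subword enum_filter; apply/map_subseq/filter_subseq. Qed.

Lemma size_subword n (pi : 'S_n) I : size (subword pi I) = #|I|.
Proof. by rewrite size_map -cardE. Qed.

Lemma subseq_word n (pi : 'S_n) s : subseq s (word pi) ->
  exists I, subword pi I = s.
Proof.
case/subseqP=> m _ ->; pose I := [set x in mask m (enum 'I_n)].
have enum_I : enum I = mask m (enum 'I_n).
  rewrite [RHS](subseq_uniqP (enum_uniq _) (mask_subseq _ _)).
  by rewrite enum_filter; apply: eq_filter => x; rewrite inE.
by exists I; rewrite /word -map_mask -enum_I.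
Qed.

Lemma enum_pos_itv n i j : 0 < i ->
  enum (pos_itv n i j) = take (j.+1 - i) (drop i.-1 (enum 'I_n)).
Proof.
move=> i_gt0; apply: (inj_map val_inj).
rewrite map_take map_drop val_enum_ord.
apply: (irr_sorted_eq ltn_trans ltnn).
- rewrite enum_filter.
  apply: (subseq_sorted ltn_trans _ (iota_ltn_sorted 0 n)).
  by rewrite -val_enum_ord; apply/map_subseq/filter_subseq.
- by rewrite drop_iota take_iota iota_ltn_sorted.
move=> k; rewrite drop_iota take_iota mem_iota.
apply/mapP/idP => [[x]|k_itv].
  by rewrite mem_enum inE => ? ->; have := ltn_ord x; rewrite /=; lia.
have lt_kn : k < n by lia.
by exists (Ordinal lt_kn); rewrite // mem_enum inE /=; lia.
Qed.

Lemma triangle_word n (pi : 'S_n) : is_triangle (triangle pi) (word pi).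
Proof.
move=> i j i_gt0; rewrite /triangle /subword enum_pos_itv //.
by rewrite /factor /word map_take map_drop.
Qed.

Theorem mainTheorem9 (n : nat) (pi : 'S_n) (c : seq nat)
    (c_nonempty : 1 <= size c) (c_pos : all (fun m => 0 < m) c) :
  procedure (triangle pi) n c = ls (Dset c) pi.
Proof.
have c_n0 : c != [::] by rewrite -size_eq0 -lt0n.
have tri := triangle_word pi; have uw := word_uniq pi.
have lastE j : 0 < j -> (triangle pi j n).1 = lis (drop j.-1 (word pi)).
  move=> j_gt0; rewrite tri //= /factor take_oversize //.
  by rewrite size_drop size_word; lia.
have word_set s : subseq s (word pi) ->
    exists2 I, subword pi I = s & #|I| = size s.
  by case/subseq_word=> I <-; exists I; rewrite // size_subword.
(* [Dset c] is nonempty, so the empty word does not have this descent set. *)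
have descent : (sumn c).-1.+1 \in Dset c.
  by rewrite in_Dset -size_pattern nth_last last_pattern.
have upper (I : {set 'I_n}) : Des (subword pi I) == Dset c ->
    exists j, [/\ run (triangle pi) n c 1 = Some j, 0 < j &
      #|I| <= sumn c + lis (drop j.-1 (word pi))].
  rewrite -(size_subword pi); have := subword_subseq pi I.
  case: (subword pi I) => [_ /eqP D0|y s sub_s].
    by move: descent; rewrite -D0 !inE.
  case/(Des_Dset y s c_n0 c_pos)=> r pat_s.
  have := @run_upper _ _ c 1 y s r tri uw isT.
  by rewrite size_word drop0; apply.
rewrite procedureE /ls; case run_c: run => [j|]; last first.
  by rewrite big_pred0 // => I; apply/negP => /upper[j []]; rewrite run_c.
(* For [n = 0] the first search runs over an empty range and fails. *)
have n_gt0 : 0 < n.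
  case: (posnP n) => // n0; move: (triangle pi) run_c => a; rewrite n0.
  by case: (c) c_nonempty.
have := @run_lower (triangle pi) (word pi) c 1 j tri uw c_pos.
rewrite size_word => /(_ n_gt0 run_c) [y [s [r [j_gt0 sub_s pat_s sz_s _]]]].
rewrite lastE // -sz_s; apply/eqP; rewrite eqn_leq; apply/andP; split.
  rewrite drop0 in sub_s; have [I EI <-] := word_set _ sub_s.
  apply: leq_bigmax_cond; rewrite EI; apply/(Des_Dset y s c_n0 c_pos).
  by exists r.
apply/bigmax_leqP => I /upper [j']; rewrite run_c sz_s => -[[<-] _].
exact.
Qed.
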